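(* Let $\mathcal{B}\subset\mathscr{B}(G)$ be a von Neumann algebra acting non-degenerately on a Hilbert space $G$. Every von Neumann $\mathcal{B}$-module $E$ is self-dual, i.e. for every bounded right $\mathcal{B}$-linear mapping $\Phi\colon E\to\mathcal{B}$ there is a (unique) $x\in E$ such that $\Phi(y)=\langle x,y\rangle$ for all $y\in E$.
   Context: $\mathscr{B}(G)$ denotes all bounded operators on $G$, and $\mathscr{B}(G,H)$ all bounded operators $G\to H$. Inner products are linear in the second argument. Let $E$ be a (right) Hilbert module over $\mathcal{B}\subset\mathscr{B}(G)$. The Hilbert space $H=E\odot G$ is the interior tensor product over $\mathcal{B}$, i.e. the completion of the span of elementary tensors $x\odot g$ ($x\in E$, $g\in G$) with inner product $\langle x_1\odot g_1,x_2\odot g_2\rangle=\langle g_1,\langle x_1,x_2\rangle g_2\rangle$ (modulo null vectors). Every $x\in E$ defines $L_x\in\mathscr{B}(G,H)$, $L_xg=x\odot g$; one has $L_{xb}=L_xb$ and $L_x^*L_y=\langle x,y\rangle$. Via $x\mapsto L_x$ one identifies $E$ with a subspace of $\mathscr{B}(G,H)$. $E$ is called a von Neumann $\mathcal{B}$-module if $E$ is closed in $\mathscr{B}(G,H)$ in the strong operator topology. *)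

(* Defs.v *)
From HB Require Import structures.
From mathcomp Require Import all_boot all_order all_algebra.
From mathcomp Require Import complex.
From mathcomp Require Import all_classical all_reals all_analysis.

Set Implicit Arguments.
Unset Strict Implicit.
Unset Printing Implicit Defensive.

Import Order.TTheory GRing.Theory Num.Theory.
Import numFieldNormedType.Exports.

Local Open Scope classical_set_scope.
Local Open Scope ring_scope.
Local Open Scope complex_scope.

(* Complex Hilbert spaces.  A form of type {dot T for conj} is linear in its
   FIRST argument; [hinner] swaps the arguments, so that inner products are
   linear in the second one. *)
HB.mixin Record isHilbert (R : realType) T
    of CompleteNormedModule R[i] T := {
  hdot : {dot T for @Num.conj R[i]} ;
  hdot_normE : forall x : T, `|x| ^+ 2 = hdot x x
}.

#[short(type="hilbertType")]
HB.structure Definition Hilbert (R : realType) :=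
  {T of CompleteNormedModule R[i] T & isHilbert R T}.

Definition hinner (R : realType) (G : hilbertType R) (g h : G) : R[i] :=
  hdot h g.

Lemma hdot_CauchySchwarz (R : realType) (G : hilbertType R) (u v : G) :
  `|hdot u v| <= `|u| * `|v|.
Proof.
rewrite -(@ler_pXn2r _ 2) ?nnegrE ?mulr_ge0// exprMn !hdot_normE.
have [->|nz_v] := eqVneq v 0.
  by rewrite !(linear0r hdot) normr0 expr0n/= mulr0.
have v0 : 0 < hdot v v by rewrite dnorm_gt0.
pose a := hdot u v / hdot v v; pose u1 := u - a *: v.
have ou : hdot u1 v = 0.
  by rewrite linearBl/= linearZl_LR/= divfK ?gt_eqF ?subrr.
rewrite (canRL (subrK _) (erefl u1)) linearDl/= ou add0r.
rewrite linearZl_LR/= normrM (ger0_norm (dnorm_ge0 _ _)).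
rewrite exprMn [hdot v v ^+ 2]expr2 mulrA -dnormZ ler_wpM2r ?dnorm_ge0//.
rewrite hnormDd/=; last by rewrite linearZr_LR/= ou mulr0.
by rewrite lerDr dnorm_ge0.
Qed.

Section Operators.
Variable R : realType.

(* the set B(G, H), and B(G) = bounded_operator G G *)
Definition bounded_operator (G H : hilbertType R) : set (G -> H) :=
  [set T | linear T /\ exists M : R[i], forall g, `|T g| <= M * `|g|].

Definition adjoint (G H : hilbertType R) (T : G -> H) (S : H -> G) : Prop :=
  forall h g, hinner h (T g) = hinner (S h) g.

Definition is_opnorm (G H : hilbertType R) (T : G -> H) (r : R[i]) : Prop :=
  [/\ 0 <= r, forall g, `|T g| <= r * `|g| &
      forall M : R[i], 0 <= M -> (forall g, `|T g| <= M * `|g|) -> r <= M].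

Definition positive_operator (G : hilbertType R) (T : G -> G) : Prop :=
  forall g, 0 <= hinner g (T g).

(* The strong operator topology on B(G, H) is the topology of pointwise
   convergence, restricted to the bounded operators. *)
Definition sot_closed (G H : hilbertType R) (S : set (G -> H)) : Prop :=
  closure (S : set {ptws G -> H}) `&` @bounded_operator G H `<=` S.

Definition lspan (V : lmodType R[i]) (S : set V) : set V :=
  [set v | exists (n : nat) (c : 'I_n -> R[i]) (s : 'I_n -> V),
     (forall i, S (s i)) /\ v = \sum_(i < n) c i *: s i].

(* No unit is required here: non-degeneracy is a separate hypothesis. *)
Record von_neumann_algebra (G : hilbertType R) (B : set (G -> G)) : Prop := {
  vna_bounded : B `<=` @bounded_operator G G ;
  vna0 : B 0 ;
  vna_linear : forall (k : R[i]) a b, B a -> B b -> B (k *: a + b) ;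
  vna_comp : forall a b, B a -> B b -> B (a \o b) ;
  vna_adjoint : forall a, B a -> exists2 b, B b & adjoint a b ;
  vna_closed : sot_closed B
}.

Definition acts_nondegenerately (G : hilbertType R) (B : set (G -> G)) : Prop :=
  dense (lspan [set v | exists b g, B b /\ v = b g]).

End Operators.

(* Right Hilbert modules over B.  The right action [hmact] is a total function
   on all maps G -> G, but nothing is assumed of [hmact x b] unless b is in B.
   The last axiom says that the norm of E, for which E is complete, is
   x |-> ||<x, x>|| ^ (1/2). *)
HB.mixin Record isHilbertModule (R : realType) (G : hilbertType R)
    (B : set (G -> G)) E of CompleteNormedModule R[i] E := {
  hmact : E -> (G -> G) -> E ;
  hmdot : E -> E -> (G -> G) ;
  hmact_linearl : forall b, B b -> linear (hmact ^~ b) ;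
  hmact_linearr : forall x (k : R[i]) b c, B b -> B c ->
    hmact x (k *: b + c) = k *: hmact x b + hmact x c ;
  hmact_comp : forall x b c, B b -> B c -> hmact x (b \o c) = hmact (hmact x b) c ;
  hmdot_in : forall x y, B (hmdot x y) ;
  hmdot_linear : forall x, linear (hmdot x) ;
  hmdot_act : forall x y b, B b -> hmdot x (hmact y b) = hmdot x y \o b ;
  hmdot_adjoint : forall x y, adjoint (hmdot x y) (hmdot y x) ;
  hmdot_ge0 : forall x, positive_operator (hmdot x x) ;
  hmdot_eq0 : forall x, hmdot x x = 0 -> x = 0 ;
  hmdot_norm : forall x : E, is_opnorm (hmdot x x) (`|x| ^+ 2)
}.

#[short(type="hilbertModType")]
HB.structure Definition HilbertModule (R : realType) (G : hilbertType R)
    (B : set (G -> G)) :=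
  {E of CompleteNormedModule R[i] E & isHilbertModule R G B E}.

Section Modules.
Variables (R : realType) (G : hilbertType R) (B : set (G -> G)).
Variable E : hilbertModType B.

(* The Hilbert space H, with elementary tensors [tens x g], is the interior
   tensor product of E and G over B: a completion of the span of the elementary
   tensors for the given inner product.  Null vectors vanish because the inner
   product of H is definite, and this also makes [tens] bilinear and
   B-balanced.  H is unique up to a unitary preserving the elementary tensors. *)
Definition interior_tensor (H : hilbertType R) (tens : E -> G -> H) : Prop :=
  (forall x1 x2 g1 g2,
     hinner (tens x1 g1) (tens x2 g2) = hinner g1 (hmdot x1 x2 g2)) /\
  dense (lspan [set v | exists x g, v = tens x g]).

Lemma interior_tensor_bounded (H : hilbertType R) (tens : E -> G -> H) :
  von_neumann_algebra B -> interior_tensor tens ->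
  forall x, bounded_operator (tens x).
Proof.
move=> hB [innerE _] x.
have dotE u v a b : hdot (tens u a) (tens v b) = hdot (hmdot v u a) b.
  exact: (innerE v u b a).
split.
  move=> k g h; apply/eqP; rewrite -subr_eq0; set w := _ - _.
  have w0 y : hdot w (tens x y) = 0.
    have [dlin _] := vna_bounded hB (hmdot_in x x).
    rewrite /w linearBl/= linearDl/= linearZl_LR/= !dotE dlin.
    by rewrite linearDl/= linearZl_LR/= subrr.
  rewrite -(dnorm_eq0 hdot) {2}/w linearBr linearDr linearZr_LR/= !w0.
  by rewrite mulr0 addr0 subr0.
exists `|x| => g.
have [_ xg _] := hmdot_norm x.
rewrite -(@ler_pXn2r _ 2) ?nnegrE ?mulr_ge0// hdot_normE dotE exprMn.
rewrite -[leLHS]ger0_norm; last by rewrite -dotE dnorm_ge0.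
rewrite (le_trans (hdot_CauchySchwarz _ _))//.
by rewrite [`|g| ^+ 2]expr2 mulrA ler_wpM2r.
Qed.

(* L_x is the partial application [tens x] : G -> H. *)
Definition von_neumann_module : Prop :=
  exists (H : hilbertType R) (tens : E -> G -> H),
    interior_tensor tens /\ sot_closed (range tens).

Definition self_dual : Prop :=
  forall Phi : E -> (G -> G),
    (forall y, B (Phi y)) ->
    linear Phi ->
    (forall y b, B b -> Phi (hmact y b) = Phi y \o b) ->
    (exists M : R[i], forall y g, `|Phi y g| <= M * `|y| * `|g|) ->
    exists! x : E, forall y, Phi y = hmdot x y.

End Modules.

(* Main.v *)
(* Phi induces an operator L : x (.) g |-> Phi(x) g on the span of the elementary
   tensors.  It is bounded: with X v = sum_j x_j (.) v_j and
   Psi v = sum_j Phi(x_j) v_j on G^n, the solution u of (X* X + e) u = Psi* has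
   entries in B, so z = sum_j x_j u_j lies in E and
     |z (.) k|^2 <= <k, Phi(z) k> <= |Phi| |z| |k|^2,
   whence |z| <= |Phi|; as <Psi v, k> = <v, (X* X + e) u k>, Cauchy-Schwarz for
   the form of X* X + e and k = Psi v give |Psi v|^2 <= |Phi|^2 (|X v|^2 + e |v|^2).
   The adjoint T of L is a strong limit of elements of E: if the v_i are the
   components of (T g_i) orthogonal to all (x (.) g_i), then, as L_y L_y^* maps
   both T and E into E, sum_i |L_y^* v_i|^2 = 0 for every y, so v_i = 0.
   Hence T = L_x with x in E.  All inner products are used through their real
   parts. *)
Require Import Defs.
From mathcomp Require Import all_boot all_order all_algebra.
From mathcomp Require Import complex ring lra.
From mathcomp Require Import all_classical all_reals all_analysis.

Set Implicit Arguments.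
Unset Strict Implicit.
Unset Printing Implicit Defensive.

Import Order.TTheory GRing.Theory Num.Theory.
Import numFieldNormedType.Exports.

Local Open Scope classical_set_scope.
Local Open Scope ring_scope.
Local Open Scope complex_scope.

(** * Real parts of inner products *)

Lemma linear_scale (K : pzRingType) (V W : lmodType K) (f : V -> W) (k : K) v :
  linear f -> f (k *: v) = k *: f v.
Proof.
move=> fP; have f0 : f 0 = 0.
  by have := fP (-1) 0 0; rewrite scaler0 addr0 scaleN1r addNr.
by rewrite -[k *: v]addr0 fP f0 addr0.
Qed.

Definition rdot (R : realType) (G : hilbertType R) (u v : G) : R :=
  complex.Re (hdot u v).

Section RealInnerProduct.
Variables (R : realType) (G : hilbertType R).
Implicit Types (u v w : G) (k : R).

Lemma hdotC u v : hdot u v = (hdot v u)^*.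
Proof. by rewrite hermC/= expr0 mul1r. Qed.

Lemma rdotC u v : rdot u v = rdot v u.
Proof. by rewrite /rdot hdotC; case: (hdot v u). Qed.

Lemma rdotDl u v w : rdot (u + v) w = rdot u w + rdot v w.
Proof. by rewrite /rdot linearDl/= raddfD. Qed.

Lemma rdotNl u w : rdot (- u) w = - rdot u w.
Proof. by rewrite /rdot linearNl/= raddfN. Qed.

Lemma rdotZl k u w : rdot (k%:C *: u) w = k * rdot u w.
Proof.
by rewrite /rdot linearZl_LR/=; case: (hdot u w) => a b /=; rewrite mul0r subr0.
Qed.

Lemma rdot0l w : rdot 0 w = 0.
Proof. by rewrite /rdot linear0l. Qed.

Lemma rdotBl u v w : rdot (u - v) w = rdot u w - rdot v w.
Proof. by rewrite rdotDl rdotNl. Qed.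

Lemma rdotDr u v w : rdot w (u + v) = rdot w u + rdot w v.
Proof. by rewrite !(rdotC w) rdotDl. Qed.

Lemma rdotBr u v w : rdot w (u - v) = rdot w u - rdot w v.
Proof. by rewrite !(rdotC w) rdotBl. Qed.

Lemma rdotZr k u w : rdot w (k%:C *: u) = k * rdot w u.
Proof. by rewrite !(rdotC w) rdotZl. Qed.

Lemma rdot0r w : rdot w 0 = 0.
Proof. by rewrite rdotC rdot0l. Qed.

Lemma rdot_suml I (r : seq I) (F : I -> G) w :
  rdot (\sum_(i <- r) F i) w = \sum_(i <- r) rdot (F i) w.
Proof. exact: (big_morph (fun u => rdot u w) (fun u v => rdotDl u v w) (rdot0l w)). Qed.

Lemma rdot_sumr I (r : seq I) (F : I -> G) w :
  rdot w (\sum_(i <- r) F i) = \sum_(i <- r) rdot w (F i).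
Proof. by rewrite rdotC rdot_suml; apply: eq_bigr => i _; rewrite rdotC. Qed.

Lemma hdot_self u : hdot u u = (rdot u u)%:C.
Proof.
rewrite /rdot; have := dnorm_ge0 hdot u.
by case: (hdot u u) => a b; rewrite lecE/= => /andP[/eqP -> _].
Qed.

Lemma rdot_ge0 u : 0 <= rdot u u.
Proof. by have := dnorm_ge0 hdot u; rewrite hdot_self lecR. Qed.

Lemma rdot_eq0 u : rdot u u = 0 -> u = 0.
Proof.
by move=> u0; apply/eqP; rewrite -(dnorm_eq0 hdot) hdot_self u0.
Qed.

Lemma sqr_norm_rdot u : `|u| ^+ 2 = (rdot u u)%:C.
Proof. by rewrite hdot_normE hdot_self. Qed.

Lemma norm_lt_rdot u (e : R) : 0 <= e -> (`|u| < e%:C) = (rdot u u < e ^+ 2).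
Proof.
move=> e0; rewrite -(@ltr_pXn2r _ 2) ?nnegrE ?lecR// sqr_norm_rdot.
by rewrite -rmorphXn ltcR.
Qed.

Lemma rdot_ext u v : (forall w, rdot w u = rdot w v) -> u = v.
Proof.
move=> uv; apply/eqP; rewrite -subr_eq0; apply/eqP/rdot_eq0.
by rewrite rdotBr uv subrr.
Qed.

End RealInnerProduct.

Lemma adjoint_rdot (R : realType) (G H : hilbertType R) (T : G -> H) (S : H -> G) :
  adjoint T S -> forall g h, rdot (T g) h = rdot g (S h).
Proof. by move=> TS g h; rewrite /rdot; congr complex.Re; exact: TS. Qed.

(** Testing at [g] gives the real parts and at [i g] the imaginary parts. *)
Lemma rdot_adjoint (R : realType) (G H : hilbertType R) (T : G -> H) (S : H -> G) :
  linear T -> (forall g h, rdot (T g) h = rdot g (S h)) -> adjoint T S.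
Proof.
move=> Tlin TS h g; rewrite /hinner.
have := TS g h; have := TS ('i *: g) h; rewrite /rdot linear_scale// !linearZl_LR/=.
case: (hdot (T g) h) => a b; case: (hdot g (S h)) => c d /=.
by rewrite !mul0r !mul1r !sub0r => /oppr_inj -> ->.
Qed.

(** For small [t] the linear term dominates; [t = s / (Q + 1)] is small enough and is defined even
    when [Q = 0]. This is the first-variation argument at a minimum. *)
Lemma quadratic_ge0 (R : realFieldType) (s Q : R) :
  (forall t, 2 * (t * s) <= t ^+ 2 * Q) -> s = 0.
Proof.
move=> H; have Q0 : 0 <= Q by have := H 1; have := H (-1); lra.
have Q1 : 0 < Q + 1 by lra.
pose i := (Q + 1)^-1; have i0 : 0 < i by rewrite invr_gt0.
have iQ : i * Q = 1 - i by rewrite /i; field; lra.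
have : s ^+ 2 * i <= 0.
  have si : 0 <= s ^+ 2 * i by rewrite mulr_ge0 ?sqr_ge0 ?ltW.
  have := H (s * i).
  have -> : 2 * (s * i * s) = 2 * (s ^+ 2 * i) by ring.
  have -> : (s * i) ^+ 2 * Q = s ^+ 2 * i * (i * Q) by ring.
  rewrite iQ mulrBr mulr1; have := mulr_ge0 si (ltW i0); lra.
by rewrite pmulr_lle0// => s2; apply/eqP; rewrite -sqrf_eq0 eq_le s2 sqr_ge0.
Qed.

(** * Finite direct sums of Hilbert spaces and Riesz representation *)

(** The real inner product of a direct sum, whose vectors are plain families; the summands may
    differ, so that H and G^n can be combined. *)
Definition pdot (R : realType) (I : finType) (H : I -> hilbertType R)
    (u v : forall i, H i) : R :=
  \sum_i rdot (u i) (v i).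

Section ProductInnerProduct.
Variables (R : realType) (I : finType) (H : I -> hilbertType R).
Implicit Types (u v w : forall i, H i) (k : R).

Lemma pdotC u v : pdot u v = pdot v u.
Proof. by apply: eq_bigr => i _; rewrite rdotC. Qed.

Lemma pdotDl u v w : pdot (fun i => u i + v i) w = pdot u w + pdot v w.
Proof. by rewrite /pdot -big_split; apply: eq_bigr => i _; rewrite rdotDl. Qed.

Lemma pdotZl k u w : pdot (fun i => k%:C *: u i) w = k * pdot u w.
Proof. by rewrite /pdot mulr_sumr; apply: eq_bigr => i _; rewrite rdotZl. Qed.

Lemma pdotBl u v w : pdot (fun i => u i - v i) w = pdot u w - pdot v w.
Proof. by rewrite /pdot -sumrB; apply: eq_bigr => i _; rewrite rdotBl. Qed.

Lemma pdotDr u v w : pdot w (fun i => u i + v i) = pdot w u + pdot w v.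
Proof. by rewrite !(pdotC w) pdotDl. Qed.

Lemma pdotZr k u w : pdot w (fun i => k%:C *: u i) = k * pdot w u.
Proof. by rewrite !(pdotC w) pdotZl. Qed.

Lemma pdotBr u v w : pdot w (fun i => u i - v i) = pdot w u - pdot w v.
Proof. by rewrite !(pdotC w) pdotBl. Qed.

Lemma pdot_ge0 u : 0 <= pdot u u.
Proof. by apply: sumr_ge0 => i _; exact: rdot_ge0. Qed.

Lemma rdot_le_pdot u i : rdot (u i) (u i) <= pdot u u.
Proof. by rewrite /pdot (bigD1 i)//= lerDl sumr_ge0// => j _; exact: rdot_ge0. Qed.

Lemma pdot_eq0 u : pdot u u = 0 -> forall i, u i = 0.
Proof.
move=> u0 i; apply: rdot_eq0; apply/eqP.
by rewrite eq_le rdot_ge0 andbT -u0 rdot_le_pdot.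
Qed.

Lemma pdot_young u v : 2 * pdot u v <= pdot u u + pdot v v.
Proof.
by have := pdot_ge0 (fun i => u i - v i); rewrite pdotBl !pdotBr (pdotC v u); lra.
Qed.

End ProductInnerProduct.

(* The minimum of |iota x|^2 - 2 l x over S need not be attained, but
   minimising sequences are Cauchy by the parallelogram law. *)
Lemma riesz (R : realType) (V : lmodType R[i]) (S : set V) (I : finType)
    (H : I -> hilbertType R) (iota : forall i, V -> H i) (l : V -> R) (C : R) :
  S 0 -> (forall k x y, S x -> S y -> S (k *: x + y)) ->
  (forall i, linear (iota i)) ->
  (forall (k : R) x y, l (k%:C *: x + y) = k * l x + l y) ->
  (forall x, S x ->
     2 * l x <= C + pdot (fun i => iota i x) (fun i => iota i x)) ->
  exists w : forall i, H i,
    [/\ forall x, S x -> pdot w (fun i => iota i x) = l x,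
        forall e, 0 < e -> exists2 x, S x &
          pdot (fun i => w i - iota i x) (fun i => w i - iota i x) < e &
        pdot w w <= C].
Proof.
move=> S0 SP iotaP lP lC; pose J x := fun i => iota i x.
pose q x := pdot (J x) (J x).
have JP k x y : J (k *: x + y) = fun i => k *: J x i + J y i.
  by apply: functional_extensionality_dep => i; rewrite /J iotaP.
have JB x y : J (x - y) = fun i => J x i - J y i.
  by rewrite addrC -scaleN1r JP; apply: functional_extensionality_dep => i;
     rewrite scaleN1r addrC.
pose f x := q x - 2 * l x.
have fD (t : R) x y :
    f (t%:C *: y + x) = f x + 2 * t * (pdot (J x) (J y) - l y) + t ^+ 2 * q y.
  rewrite /f /q JP lP pdotDl pdotDr pdotDr !pdotZl !pdotZr (pdotC (J y) (J x)).
  by ring.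
pose D := f @` S; pose d := inf D.
have Dlb : lbound D (- C).
  by move=> _ [x Sx <-]; rewrite /f; have := lC _ Sx; rewrite -/(q x); lra.
have hasD : has_inf D by split; [exists (f 0), 0|exists (- C)].
have df x : S x -> d <= f x.
  by move=> Sx; apply: ge_inf; [exact: hasD.2|exists x].
have para x y : S x -> S y -> q (x - y) <= 2 * (f x + f y - 2 * d).
  move=> Sx Sy.
  (* At the midpoint [f] equals (f x + f y)/2 - q(x - y)/4, which is at least [d]. *)
  have Sm : S ((2^-1 : R)%:C *: (x - y) + y).
    apply: (SP) => //; rewrite addrC -scaleN1r; exact: SP.
  have := df _ Sm; rewrite fD.
  have -> : f x = f y + 2 * (pdot (J y) (J (x - y)) - l (x - y)) + q (x - y).
    by have := fD 1 y (x - y); rewrite scale1r subrK mulr1 expr1n mul1r.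
  lra.
(* The near-minimisers in [S] give a filter, used in place of a minimising sequence. *)
pose F := filter_from [set e : R | 0 < e] (fun e => [set x | S x /\ f x < d + e]).
have FF : ProperFilter F.
  apply: filter_from_proper; last first.
    move=> e e0; have [_ [x Sx <-] fx] := inf_adherent e0 hasD.
    by exists x.
  apply: filter_from_filter; first by exists 1 => /=.
  move=> a b a0 b0; exists (Num.min a b) => /=; first by rewrite lt_min a0.
  move=> x [Sx]; rewrite -ltrBlDl lt_min => /andP[xa xb].
  by split; split => //; rewrite -ltrBlDl.
have Fe e : 0 < e -> F [set x | S x /\ f x < d + e] by move=> e0; exists e.
have cvgF i : cvg (iota i @ F).
  apply/cauchy_cvgP/cauchy_exP => eps eps0.
  have [e e0 ->] : exists2 e : R, 0 < e & eps = e%:C.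
    by move: eps0; case: eps => a b; rewrite ltcE/= => /andP[/eqP -> a0]; exists a.
  (* By [para], two points with [f < d + e^2/4] have [q (x - y) < e^2]. *)
  have e24 : 0 < e ^+ 2 / 4 by rewrite divr_gt0// exprn_gt0.
  have [x [Sx fx]] := filter_ex (Fe _ e24).
  exists (iota i x); exists (e ^+ 2 / 4) => // y [Sy fy] /=.
  rewrite -ball_normE/= norm_lt_rdot ?ltW//.
  have := para _ _ Sx Sy; have := rdot_le_pdot (J (x - y)) i.
  by rewrite -/(q (x - y)) {1 2}JB {1 2}/J; lra.
pose w i := lim (iota i @ F).
have wF e : 0 < e ->
    \forall x \near F, pdot (fun i => w i - J x i) (fun i => w i - J x i) < e.
  (* The successor keeps [n] positive for empty [I] and makes the final estimate strict. *)
  move=> e0; pose n : R := #|I|.+1%:R.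
  have n0 : 0 < n by rewrite ltr0n.
  pose c := Num.sqrt (e / n); have c0 : 0 < c by rewrite sqrtr_gt0 divr_gt0.
  have c2 : c ^+ 2 = e / n by rewrite sqr_sqrtr// ltW// divr_gt0.
  have : \forall x \near F, forall i, `|w i - iota i x| < c%:C.
    apply: filter_forall => i; have := cvgF i => /cvgrPdist_lt; apply.
    by rewrite ltcR.
  apply: filterS => x wx.
  rewrite (@le_lt_trans _ _ (\sum_(i : I) e / n))//.
    by apply: ler_sum => i _; rewrite -c2 ltW// -norm_lt_rdot ?ltW// wx.
  rewrite sumr_const -mulr_natl mulrA mulrAC gtr_pMl// ltr_pdivrMr// mul1r.
  by rewrite ltr_nat.
have wl y : S y -> pdot w (J y) = l y.
  move=> Sy; apply/eqP; rewrite -subr_eq0; apply/eqP/oppr_inj; rewrite oppr0.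
  (* One [q y] is the second-order term in f(x + t y) >= d; the other pays, by Young's inequality,
     for replacing [J x] by its limit [w]. *)
  apply: (@quadratic_ge0 _ _ (2 * q y)) => t.
  apply/ler_addgt0Pr => e e0; have e20 : 0 < e / 2 by rewrite divr_gt0.
  have [x [[Sx fx] wx]] := filter_ex (filterI (Fe _ e20) (wF _ e20)).
  have := df _ (SP t%:C _ _ Sy Sx); rewrite fD.
  have := pdot_young (fun i => (- t)%:C *: J y i) (fun i => w i - J x i).
  rewrite !pdotZl pdotZr pdotBr !(pdotC (J y)) -/(q y) => h1 h2.
  have h3 : pdot (fun i => w i - J x i) (fun i => w i - J x i) < e / 2 by [].
  move: fx h1 h2 h3; rewrite /=.
  move: (pdot (J x) (J y)) (f x) (q y) (l y) (pdot w (J y)) (pdot _ _) => a c Q L b z.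
  lra.
exists w; split=> //.
- by move=> e e0; have [x [[Sx _] wx]] := filter_ex (filterI (Fe _ ltr01) (wF _ e0));
     exists x.
- apply/ler_addgt0Pr => e e0.
  have [x [[Sx _] wx]] := filter_ex (filterI (Fe _ ltr01) (wF _ e0)).
  (* Here |w|^2 < e + 2 <w, J x> - |J x|^2, and 2 <w, J x> = 2 l x <= C + |J x|^2. *)
  have := lC _ Sx; rewrite -/(J x) -wl//; move: wx => /=.
  rewrite pdotBl !pdotBr (pdotC (J x) w); lra.
Qed.

(** * Orthogonality and approximation *)

Lemma rdot_CauchySchwarz (R : realType) (G : hilbertType R) (u v : G) :
  rdot u v ^+ 2 <= rdot u u * rdot v v.
Proof.
have [v0|v0] := eqVneq (rdot v v) 0.
  by rewrite (rdot_eq0 v0) !rdot0r expr0n mulr0.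
have v1 : 0 < rdot v v by rewrite lt_neqAle eq_sym v0 rdot_ge0.
have := rdot_ge0 ((rdot v v)%:C *: u - (rdot u v)%:C *: v).
rewrite !(rdotBl, rdotBr, rdotZl, rdotZr) (rdotC v u).
move=> h; rewrite -subr_ge0 -(pmulr_rge0 _ v1).
by apply: le_trans h _; rewrite le_eqVlt; apply/orP; left; apply/eqP; ring.
Qed.

(** From 4 s^2 <= 4 a b <= (a + b)^2. It turns a Cauchy-Schwarz estimate into the bound that [riesz]
    asks for. *)
Lemma mean_le (R : realDomainType) (s a b : R) :
  0 <= a -> 0 <= b -> s ^+ 2 <= a * b -> 2 * s <= a + b.
Proof.
move=> a0 b0 sab; rewrite leNgt; apply/negP => abs; have := sqr_ge0 (a - b).
have : (a + b) ^+ 2 < (2 * s) ^+ 2 by rewrite ltr_sqr ?nnegrE//; lra.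
by rewrite sqrrD sqrrB exprMn; lra.
Qed.

(** By Young's inequality, 2 t <p, w> = 2 t <p, w - iota x> <= t^2 |p|^2 + e for all [t] and all
    [e > 0]. *)
Lemma orthogonal_limit (R : realType) (V : Type) (S : set V) (I : finType)
    (H : I -> hilbertType R) (iota : forall i, V -> H i) (w p : forall i, H i) :
  (forall e, 0 < e -> exists2 x, S x &
     pdot (fun i => w i - iota i x) (fun i => w i - iota i x) < e) ->
  (forall x, S x -> pdot p (fun i => iota i x) = 0) ->
  pdot p w = 0.
Proof.
move=> wS pS; apply: (@quadratic_ge0 _ _ (pdot p p)) => t.
apply/ler_addgt0Pr => e /wS[x Sx wx].
have := pdot_young (fun i => t%:C *: p i) (fun i => w i - iota i x).
by rewrite !pdotZl pdotZr pdotBr pS//; lra.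
Qed.

(** Let [w] be the projection of [h] onto the closure of the image of [S]. Then [v = h - w] is
    orthogonal to the image, and every [p] orthogonal to the image is orthogonal to [w], so the last
    hypothesis forces [h = w]. *)
Lemma dense_approximation (R : realType) (V : lmodType R[i]) (S : set V) (I : finType)
    (H : I -> hilbertType R) (iota : forall i, V -> H i) (h : forall i, H i) :
  S 0 -> (forall k x y, S x -> S y -> S (k *: x + y)) ->
  (forall i, linear (iota i)) ->
  (forall v : forall i, H i,
     (forall x, S x -> pdot v (fun i => iota i x) = 0) ->
     (forall p : forall i, H i,
        (forall x, S x -> pdot p (fun i => iota i x) = 0) ->
        pdot p h = pdot p v) ->
     forall i, v i = 0) ->
  forall e, 0 < e -> exists2 x, S x &
    pdot (fun i => h i - iota i x) (fun i => h i - iota i x) < e.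
Proof.
move=> S0 SP iotaP v0.
have [|x Sx|w [wl wS _]] := @riesz R V S I H iota
  (fun x => pdot h (fun i => iota i x)) (pdot h h) S0 SP iotaP.
- move=> k x y; rewrite -pdotZr -pdotDr; congr pdot.
  by apply: functional_extensionality_dep => i; rewrite iotaP.
- exact: pdot_young.
have -> // : h = w.
  apply: functional_extensionality_dep => i.
  apply/eqP; rewrite -subr_eq0; apply/eqP; move: i; apply: v0.
    by move=> x Sx; rewrite pdotBl wl// subrr.
  by move=> p pS; rewrite pdotBr (orthogonal_limit wS pS) subr0.
Qed.

(** * Bounded operators, adjoints and strong closure *)

Lemma bounded_operatorP (R : realType) (G H : hilbertType R) (T : G -> H) :
  bounded_operator T <->
  linear T /\ exists2 C : R, 0 <= C & forall g, rdot (T g) (T g) <= C * rdot g g.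
Proof.
split=> -[Tlin]; last first.
  move=> [C C0 TC]; split=> //; exists (Num.sqrt C)%:C => g.
  rewrite -(@ler_pXn2r _ 2) ?nnegrE ?mulr_ge0// ?lecR ?sqrtr_ge0//.
  by rewrite exprMn !sqr_norm_rdot -rmorphXn/= sqr_sqrtr// -rmorphM lecR.
move=> [M TM]; split=> //; exists ((complex.Re `|M|) ^+ 2) => [|g]; first exact: sqr_ge0.
have MR : `|M| = (complex.Re `|M|)%:C by rewrite RRe_real// ger0_real.
have : `|T g| <= `|M| * `|g|.
  have := le_trans (normr_ge0 _) (TM g) => /ger0_norm.
  by rewrite normrM normr_id => ->.
rewrite -(@ler_pXn2r _ 2) ?nnegrE ?mulr_ge0// exprMn !sqr_norm_rdot MR.
by rewrite -rmorphXn -rmorphM lecR.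
Qed.

(** Each functional g |-> <T g, h> is represented by [riesz], for a family with a single member. *)
Lemma adjoint_exists (R : realType) (G H : hilbertType R) (T : G -> H) :
  bounded_operator T -> exists S : H -> G, adjoint T S.
Proof.
move=> /bounded_operatorP[Tlin [C C0 TC]].
suff /choice[S TS] : forall h, exists g', forall g, rdot (T g) h = rdot g g'.
  by exists S; apply: rdot_adjoint => // g h.
move=> h.
have pu (u v : unit -> G) : pdot (H := fun=> G) u v = rdot (u tt) (v tt).
  by rewrite /pdot (bigD1 tt)//= big1 ?addr0// => -[].
have [||||g _|w [wl _ _]] := @riesz R G setT unit (fun=> G) (fun=> id)
  (fun g => rdot (T g) h) (C * rdot h h).
- by [].
- by [].
- by [].
- by move=> k x y; rewrite Tlin rdotDl rdotZl.
- rewrite pu.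
  apply: mean_le (rdot_ge0 _) _; first by rewrite mulr_ge0 ?rdot_ge0.
  apply: le_trans (rdot_CauchySchwarz _ _) _.
  by rewrite mulrAC ler_wpM2r ?rdot_ge0.
by exists (w tt) => g; have := wl g I; rewrite pu rdotC => ->.
Qed.

(** Otherwise the ball of radius |v| around [v] meets the span in some [s] orthogonal to [v], while
    |v - s|^2 = |v|^2 + |s|^2. *)
Lemma dense_orthogonal (R : realType) (H : hilbertType R) (X : set H) (v : H) :
  dense (lspan X) -> (forall x, X x -> hdot x v = 0) -> v = 0.
Proof.
move=> dX Xv; apply/eqP/negPn/negP => v0.
have nv : 0 < `|v| by rewrite normr_gt0.
have [||s [+ [n [c [x [xX sE]]]]]] := dX (ball v `|v|).
- by exists v; exact: ballxx.
- exact: ball_open.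
rewrite -ball_normE/=.
have sv : hdot s v = 0.
  rewrite sE; elim/big_ind: _ => [|a b av bv|i _]; rewrite ?linear0l//.
    by rewrite linearDl/= av bv addr0.
  by rewrite linearZl_LR/= Xv// mulr0.
rewrite -(@ltr_pXn2r _ 2) ?nnegrE// !sqr_norm_rdot ltcR.
rewrite rdotBl !rdotBr (rdotC v s) {2 3}/rdot sv/=.
by have := rdot_ge0 s; lra.
Qed.

(** The elements of [S] close to [T] at finitely many vectors generate a filter converging pointwise
    to [T]. One [X] must serve all [g i] at once, hence the later approximations in finite direct
    sums. *)
Lemma sot_closed_approx (R : realType) (G H : hilbertType R) (S : set (G -> H))
    (T : G -> H) :
  sot_closed S -> bounded_operator T ->
  (forall (n : nat) (g : 'I_n -> G) (e : R), 0 < e -> exists2 X, S X &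
     forall i, rdot (T (g i) - X (g i)) (T (g i) - X (g i)) < e) ->
  S T.
Proof.
move=> Scl Tb TS; apply: Scl; split=> //; rewrite closureEcvg.
pose F : set_system {ptws G -> H} := filter_from
  [set a : seq G * R | 0 < a.2]
  (fun a => [set X | S X /\ forall g, g \in a.1 -> `|T g - X g| < a.2%:C]).
have FF : ProperFilter F.
  apply: filter_from_proper; last first.
    move=> [s e] /= e0;
    have [X SX Xe] := TS _ (tnth (in_tuple s)) (e ^+ 2) (exprn_gt0 _ e0).
    exists X; split=> // g /(tnthP (in_tuple s))[i ->].
    by rewrite norm_lt_rdot ?ltW.
  apply: filter_from_filter; first by exists ([::], 1) => /=.
  move=> [s a] [t b] /= a0 b0; exists (s ++ t, Num.min a b) => /=.
    by rewrite lt_min a0.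
  move=> X [SX Xst]; split; split=> // g gs.
    apply: lt_le_trans (Xst g _) _; first by rewrite mem_cat gs.
    by rewrite lecR ge_min lexx.
  apply: lt_le_trans (Xst g _) _; first by rewrite mem_cat gs orbT.
  by rewrite lecR ge_min lexx orbT.
exists F => //; split; last first.
  by move=> A SA; exists ([::], 1) => //= X [SX _]; exact: SA.
apply/(@pointwise_cvgP _ _ F T) => g; apply/cvgrPdist_lt => eps eps0.
have [e e0 ->] : exists2 e : R, 0 < e & eps = e%:C.
  by move: eps0; case: eps => a b; rewrite ltcE/= => /andP[/eqP -> a0]; exists a.
by exists ([:: g], e) => //= X [_]; apply; rewrite inE.
Qed.

Lemma rdotZ_conj (R : realType) (G : hilbertType R) (k : R[i]) (u v : G) :
  rdot (k *: u) v = rdot u (k^* *: v).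
Proof. by rewrite /rdot linearZl_LR linearZr_LR/= conjCK. Qed.

Lemma vna_linear_op (R : realType) (G : hilbertType R) (B : set (G -> G)) b :
  von_neumann_algebra B -> B b -> linear b.
Proof. by move=> hB /(vna_bounded hB)[]. Qed.

(** * The interior tensor product *)

Section InteriorTensor.
Variables (R : realType) (G : hilbertType R) (B : set (G -> G)).
Variables (E : hilbertModType B) (H : hilbertType R) (tens : E -> G -> H).
Hypothesis hB : von_neumann_algebra B.
Hypothesis hT : interior_tensor tens.

Implicit Types x y z : E.

Local Notation gdot := (pdot (H := fun=> G)).

Lemma rdot_tens x y a b : rdot (tens x a) (tens y b) = rdot (hmdot y x a) b.
Proof. by congr complex.Re; exact: (hT.1 y x b a). Qed.

Lemma tens_linearr x : linear (tens x).
Proof. by have [] := interior_tensor_bounded hB hT x. Qed.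

Lemma hmdot_linear_op x y : linear (hmdot x y).
Proof. exact: vna_linear_op hB (hmdot_in x y). Qed.

(** Real parts suffice because i (y (.) b) = y (.) (i b) is again an elementary tensor. *)
Lemma tens_ext u v : (forall y b, rdot u (tens y b) = rdot v (tens y b)) -> u = v.
Proof.
move=> uv; apply/eqP; rewrite -subr_eq0; apply/eqP.
apply: (dense_orthogonal hT.2) => _ [y [b ->]].
have Re0 c : rdot (tens y c) (u - v) = 0 by rewrite rdotC rdotBl uv subrr.
have := Re0 b; have := Re0 ('i *: b); rewrite linear_scale; last exact: tens_linearr.
rewrite /rdot linearZl_LR/=; case: (hdot _ _) => p q /=.
by rewrite mul0r mul1r sub0r => /eqP; rewrite oppr_eq0 => /eqP -> ->.
Qed.

Lemma tens_linearl g : linear (tens ^~ g).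
Proof.
move=> k x y; apply: tens_ext => z b.
rewrite rdotDl rdotZ_conj -(linear_scale _ _ (tens_linearr z)) !rdot_tens.
by rewrite hmdot_linear rdotDl -rdotZ_conj.
Qed.

Lemma tens_act x b g : B b -> tens (hmact x b) g = tens x (b g).
Proof. by move=> Bb; apply: tens_ext => y c; rewrite !rdot_tens hmdot_act. Qed.

Lemma tens_sum n (x : 'I_n -> E) g : tens (\sum_i x i) g = \sum_i tens (x i) g.
Proof.
have t0 : tens 0 g = 0.
  by have := @linear_scale _ _ _ (tens ^~ g) 0 0 (tens_linearl g); rewrite /= !scale0r.
have tD a b : tens (a + b) g = tens a g + tens b g.
  by have := tens_linearl g 1 a b; rewrite !scale1r.
exact: (big_morph (tens ^~ g) tD t0).
Qed.

(** With a = <z, z> g, Cauchy-Schwarz gives |a|^2 = <z (.) g, z (.) a> <= c |g| |a|; and |z|^2 is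
    the operator norm of <z, z>. *)
Lemma norm_le_tens (z : E) (c : R) : 0 <= c ->
  (forall k, rdot (tens z k) (tens z k) <= c * rdot k k) -> `|z| ^+ 2 <= c%:C.
Proof.
move=> c0 zc; have [_ _ zmin] := hmdot_norm z; apply: zmin => [|g]; first by rewrite lecR.
rewrite -(@ler_pXn2r _ 2) ?nnegrE ?mulr_ge0 ?lecR//.
rewrite exprMn !sqr_norm_rdot -rmorphXn -rmorphM lecR/=.
set a := hmdot z z g.
have h : rdot a a ^+ 2 <= (c * rdot g g) * (c * rdot a a).
  have aE : rdot a a = rdot (tens z g) (tens z a) by rewrite rdot_tens.
  rewrite {1}aE (le_trans (rdot_CauchySchwarz _ _))//.
  by rewrite ler_pM ?rdot_ge0.
have [->|s0] := eqVneq (rdot a a) 0; first by rewrite mulr_ge0 ?sqr_ge0 ?rdot_ge0.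
have s1 : 0 < rdot a a by rewrite lt_neqAle eq_sym s0 rdot_ge0.
rewrite -(ler_pM2r s1) -expr2 (le_trans h)// le_eqVlt; apply/orP; left.
by apply/eqP; ring.
Qed.

(** * The regularised Gram operator on G^n *)

Section Gram.
Variables (n : nat) (x : 'I_n -> E) (e : R).
Hypothesis e0 : 0 < e.

Definition tsum (v : 'I_n -> G) : H := \sum_j tens (x j) (v j).

(** The operator X* X + e of the header, with X* X given by its matrix <x_i, x_l>; [tsum] is X. *)
Definition gram (v : 'I_n -> G) : 'I_n -> G :=
  fun i => \sum_l hmdot (x i) (x l) (v l) + e%:C *: v i.

Lemma gdot_gram v h : gdot (gram v) h = rdot (tsum v) (tsum h) + e * gdot v h.
Proof.
rewrite /pdot /gram /tsum mulr_sumr rdot_sumr -big_split/=.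
apply: eq_bigr => i _; rewrite rdotDl rdotZl !rdot_suml.
by congr (_ + _); apply: eq_bigr => l _; rewrite rdot_tens.
Qed.

Lemma gdot_gramC v h : gdot (gram v) h = gdot v (gram h).
Proof. by rewrite (pdotC v) !gdot_gram rdotC pdotC. Qed.

Lemma gram_linear : linear gram.
Proof.
move=> k v w; apply/funext => i; rewrite /gram.
under eq_bigr do rewrite (hmdot_linear_op _ _ k (v _) (w _)).
rewrite big_split/= -scaler_sumr.
rewrite -[(k *: _ + _) i]/(k *: v i + w i) -[RHS]/(k *: (_ + _) + (_ + _)).
by rewrite !scalerDr addrACA !scalerA mulrC.
Qed.

(** Young's inequality for [gram v] and [e v], with <gram v, v> >= e |v|^2. *)
Lemma gram_coercive v : e ^+ 2 * gdot v v <= gdot (gram v) (gram v).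
Proof.
have := pdot_young (H := fun=> G) (gram v) (fun i => e%:C *: v i).
rewrite pdotZl !pdotZr gdot_gram.
have := mulr_ge0 (ltW e0) (rdot_ge0 (tsum v)).
by rewrite expr2 mulrDr; lra.
Qed.

Lemma gram_inj v w : gram v = gram w -> v = w.
Proof.
move=> vw; have d0 : gram (v - w) = 0.
  by rewrite addrC -scaleN1r gram_linear vw scaleN1r addNr.
apply/eqP; rewrite -subr_eq0; apply/eqP/funext => i.
apply: (@pdot_eq0 _ _ (fun=> G)); apply/eqP.
have := gram_coercive (v - w).
rewrite d0 [X in _ <= X]/pdot big1; last by move=> j _; rewrite rdot0l.
by rewrite pmulr_rle0 ?exprn_gt0// => h; rewrite eq_le h pdot_ge0.
Qed.

(** With s^2 = e, <gram v, h> is the inner product of (X v, s v) and (X h, s h) in the sum of H and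
    G^n. Riesz represents h |-> <k, h> by a limit [w] of such pairs; as X has a closed graph, [w] is
    such a pair itself. *)
Lemma gram_surj (k : 'I_n -> G) : exists v, gram v = k.
Proof.
pose s := Num.sqrt e; have s0 : 0 < s by rewrite sqrtr_gt0.
have s2 : s * s = e by rewrite -expr2 sqr_sqrtr ?ltW.
pose K (o : unit + 'I_n) : hilbertType R := if o is inr _ then G else H.
pose iota (o : unit + 'I_n) : ('I_n -> G) -> K o :=
  match o with inl _ => tsum | inr j => fun v => s%:C *: v j end.
have pK (u v : forall o, K o) :
    pdot u v = rdot (u (inl tt)) (v (inl tt)) +
      gdot (fun j => u (inr j)) (fun j => v (inr j)).
  rewrite /pdot big_sumType/=; congr (_ + _).
  by rewrite (bigD1 tt)//= big1 ?addr0// => -[].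
have iotaP o : linear (iota o).
  case: o => [[]|j] c u v /=.
    rewrite /tsum scaler_sumr -big_split; apply: eq_bigr => j _ /=.
    exact: tens_linearr.
  by rewrite scalerDr !scalerA mulrC.
have [||||v _|w [wl wS _]] := @riesz R ('I_n -> G) setT _ K iota
  (fun h => gdot k h) (gdot k k * e^-1).
- by [].
- by [].
- exact: iotaP.
- by move=> c u v; rewrite -pdotZr -pdotDr.
- rewrite pK/= pdotZl pdotZr mulrA s2.
  have := pdot_young (H := fun=> G) (fun i => e^-1%:C *: k i) v.
  rewrite !pdotZl pdotZr => /(ler_wpM2l (ltW e0)); have := rdot_ge0 (tsum v).
  have -> : e * (2 * (e^-1 * gdot k v)) = 2 * gdot k v by field; rewrite gt_eqF.
  have -> : e * (e^-1 * (e^-1 * gdot k k) + gdot v v) = gdot k k / e + e * gdot v v.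
    by field; rewrite gt_eqF.
  by rewrite /=; lra.
pose v j := s^-1%:C *: w (inr j) : G.
have w0 : w (inl tt) = tsum v.
  apply: tens_ext => y b.
  (* This [p] is orthogonal to every (X h, s h), hence to [w], so the first component of [w] and X v
     agree against y (.) b. *)
  pose p (o : unit + 'I_n) : K o := match o with
    inl _ => tens y b | inr j => - (s^-1%:C *: hmdot (x j) y b) end.
  have pS h : setT h -> pdot p (fun o => iota o h) = 0.
    move=> _; rewrite pK/= /tsum rdot_sumr /pdot -big_split big1//= => j _.
    rewrite rdotNl rdotZl rdotZr mulrA mulVf ?gt_eqF// mul1r rdot_tens.
    by rewrite subrr.
  have := orthogonal_limit wS pS; rewrite pK/= => /eqP; rewrite addr_eq0.
  rewrite rdotC => /eqP ->; rewrite rdotC rdot_sumr /pdot -sumrN.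
  apply: eq_bigr => j _.
  by rewrite rdotNl opprK rdotZl rdot_tens rdotZr.
exists v; apply/funext => i; apply/eqP; rewrite -subr_eq0; apply/eqP.
move: i; apply: (@pdot_eq0 _ _ (fun=> G)).
rewrite pdotBl; apply/eqP; rewrite subr_eq0; apply/eqP.
set h := (X in gdot _ X); rewrite -(wl h I) pK/= gdot_gram w0; congr (_ + _).
by rewrite pdotZr pdotZl -s2 mulrA mulfK// gt_eqF.
Qed.
Lemma vna_sum m (b : 'I_m -> G -> G) : (forall i, B (b i)) -> B (\sum_i b i).
Proof.
move=> Bb; apply: big_ind => [|a c Ba Bc|i _]; [exact: vna0 hB| |exact: Bb].
by rewrite -[a]scale1r; exact: vna_linear.
Qed.

(** The pointwise solutions are linear by injectivity and bounded by coercivity. Their components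
    lie in [B] as strong limits of tuples from [B], a set of tuples that [gram] preserves. *)
Lemma gram_solve (c : 'I_n -> G -> G) : (forall i, B (c i)) ->
  exists2 u : 'I_n -> G -> G, forall j, B (u j) &
    forall g, gram (fun j => u j g) = fun i => c i g.
Proof.
move=> Bc; have /choice[U UE] : forall g, exists v, gram v = fun i => c i g.
  by move=> g; exact: gram_surj.
have Ulin : linear U.
  move=> k g h; apply: gram_inj; rewrite gram_linear !UE; apply/funext => i.
  exact: vna_linear_op hB (Bc i) _ _ _.
have /choice[C CP] i : exists C : R, forall g, rdot (c i g) (c i g) <= C * rdot g g.
  by have /bounded_operatorP[_ [C _ ?]] := vna_bounded hB (Bc i); exists C.
have Ubounded j : bounded_operator (fun g => U g j).
  apply/bounded_operatorP; split; first by move=> k g h; rewrite Ulin.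
  have Cc g : gdot (U g) (U g) <= (\sum_i C i) / e ^+ 2 * rdot g g.
    rewrite mulrAC ler_pdivlMr ?exprn_gt0// mulrC (le_trans (gram_coercive _))//.
    by rewrite UE mulr_suml; apply: ler_sum => i _.
  exists (`|(\sum_i C i) / e ^+ 2|) => // g.
  apply: le_trans (rdot_le_pdot (H := fun=> G) (U g) j) _.
  by rewrite (le_trans (Cc g))// ler_wpM2r ?rdot_ge0// ler_norm.
exists (fun j g => U g j) => [j|g]; last exact: UE.
apply: sot_closed_approx (vna_closed hB) (Ubounded j) _ => m g d d0.
pose S : set ('I_n -> G -> G) := [set b | forall j, B (b j)].
pose iota (p : 'I_m * 'I_n) (b : 'I_n -> G -> G) : G := b p.2 (g p.1).
have pE (v w : 'I_m * 'I_n -> G) : pdot (H := fun=> G) v w =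
    \sum_i gdot (fun j => v (i, j)) (fun j => w (i, j)).
  by rewrite /pdot pair_bigA/=; apply: eq_bigr => -[].
have [||||b Sb bd] := @dense_approximation R _ S _ (fun=> G) iota
  (fun p => U (g p.1) p.2) _ _ _ _ d d0.
- by move=> i; exact: vna0 hB.
- by move=> k a b Sa Sb i; exact: vna_linear.
- by move=> p k a b.
- move=> v vS vp.
  have gramS b : S b -> S (fun i h => gram (fun j => b j h) i).
    move=> Sb i; rewrite /gram.
    rewrite (_ : (fun _ => _) =
        e%:C *: b i + \sum_l (hmdot (x i) (x l) \o b l)); last first.
      by apply/funext => h; rewrite addrC fct_sumE.
    apply: vna_linear => //; apply: vna_sum => l.
    exact: (vna_comp hB) (hmdot_in _ _) _.
  (* Since [gram] is symmetric and preserves tuples from [B], [p = gram v] is orthogonal to them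
     like [v], and <p, U> = <v, gram U> = <v, c> = 0. Hence e |v|^2 <= <p, v> = <p, U> = 0. *)
  pose p (q : 'I_m * 'I_n) := gram (fun j => v (q.1, j)) q.2.
  have pS b : S b -> pdot (H := fun=> G) p (fun q => iota q b) = 0.
    move=> Sb; rewrite -(vS _ (gramS _ Sb)) !pE.
    apply: eq_bigr => i _.
    exact: (gdot_gramC (fun j => v (i, j)) (fun j => b j (g i))).
  have lep : e * pdot (H := fun=> G) v v <= pdot (H := fun=> G) p v.
    rewrite !pE mulr_sumr; apply: ler_sum => i _.
    rewrite [leRHS](gdot_gram (fun j => v (i, j)) (fun j => v (i, j))).
    by rewrite lerDr rdot_ge0.
  have p0 : pdot (H := fun=> G) p v = 0.
    rewrite -vp// -(vS _ Bc) !pE; apply: eq_bigr => i _.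
    rewrite [LHS](gdot_gramC (fun j => v (i, j)) (fun j => U (g i) j)).
    by rewrite (UE (g i)).
  apply: (@pdot_eq0 _ _ (fun=> G)); apply/eqP; rewrite eq_le pdot_ge0 andbT.
  by move: lep; rewrite p0 pmulr_rle0.
exists (b j) => // i.
exact: le_lt_trans (rdot_le_pdot (H := fun=> G) _ (i, j)) bd.
Qed.

End Gram.

(** * The bound on L, and its adjoint T *)

Variables (Phi : E -> G -> G) (m : R).
Hypothesis PhiB : forall y, B (Phi y).
Hypothesis Phi_linear : linear Phi.
Hypothesis Phi_act : forall y b, B b -> Phi (hmact y b) = Phi y \o b.
Hypothesis m0 : 0 < m.
Hypothesis Phi_bounded : forall y g,
  rdot (Phi y g) (Phi y g) <= (m * complex.Re `|y|) ^+ 2 * rdot g g.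

Lemma Phi_sum n (x : 'I_n -> E) g : Phi (\sum_i x i) g = \sum_i Phi (x i) g.
Proof.
have P0 : Phi 0 = 0 by rewrite -[0 in LHS](scale0r 0) linear_scale// scale0r.
have PD a b : Phi (a + b) = Phi a + Phi b.
  by have := Phi_linear 1 a b; rewrite !scale1r.
by rewrite (big_morph Phi PD P0) fct_sumE.
Qed.

(* In the notation of the header, k is Psi v. *)
Lemma amplified_bound n (x : 'I_n -> E) (v : 'I_n -> G) :
  rdot (\sum_j Phi (x j) (v j)) (\sum_j Phi (x j) (v j)) <=
  m ^+ 2 * rdot (tsum x v) (tsum x v).
Proof.
set k := \sum_j _; set X := tsum x v.
(* Let [e] tend to 0; the 1 added to the denominator below covers [v = 0]. *)
suff ke e : 0 < e -> rdot k k <= m ^+ 2 * (rdot X X + e * gdot v v).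
  apply/ler_addgt0Pr => d d0; have V0 := pdot_ge0 (H := fun=> G) v.
  have V1 : 0 < m ^+ 2 * gdot v v + 1 by rewrite ltr_wpDl// mulr_ge0 ?sqr_ge0.
  apply: le_trans (ke (d / (m ^+ 2 * gdot v v + 1)) _) _; first exact: divr_gt0.
  rewrite mulrDr lerD2l mulrA mulrAC mulrA ler_pdivrMr// mulrC.
  by rewrite ler_wpM2l ?ltW// ltrDl.
move=> e0.
have /choice[c cP] j : exists c, B c /\ adjoint (Phi (x j)) c.
  by have [c Bc ?] := vna_adjoint hB (PhiB (x j)); exists c.
(* The [c j] are the entries of Psi*; the [u j] lie in [B], so they can act on [E] to form [z]. *)
have [u Bu uE] := gram_solve x e0 (fun i => (cP i).1).
pose z := \sum_j hmact (x j) (u j).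
have tz g : tens z g = tsum x (fun j => u j g).
  by rewrite tens_sum; apply: eq_bigr => j _; rewrite tens_act.
have Pz g : Phi z g = \sum_j Phi (x j) (u j g).
  by rewrite Phi_sum; apply: eq_bigr => j _; rewrite Phi_act.
have cE h g : gdot (fun j => c j g) h = rdot g (\sum_j Phi (x j) (h j)).
  rewrite rdot_sumr; apply: eq_bigr => j _.
  by rewrite rdotC -(adjoint_rdot (cP j).2) rdotC.
have zE g : rdot (tens z g) (tens z g) + e * gdot (fun j => u j g) (fun j => u j g)
    = rdot g (Phi z g).
  by rewrite Pz -cE -uE gdot_gram tz.
pose r := complex.Re `|z|.
have rE : `|z| = r%:C by rewrite /r RRe_real// ger0_real.
have r0 : 0 <= r by have := normr_ge0 z; rewrite rE lecR.
have gPg g : rdot g (Phi z g) <= m * r * rdot g g.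
  have mr0 : 0 <= m * r * rdot g g by rewrite !mulr_ge0 ?rdot_ge0// ltW.
  apply: le_trans (ler_norm _) _.
  rewrite -(@ler_pXn2r _ 2) ?nnegrE// real_normK ?num_real//.
  apply: le_trans (rdot_CauchySchwarz _ _) _.
  by rewrite exprMn [rdot g g ^+ 2]expr2 mulrCA ler_wpM2l ?rdot_ge0.
(* From |z|^2 <= m |z|, where |z| cancels unless it is 0. *)
have rm : r <= m.
  have : r ^+ 2 <= m * r.
    suff : `|z| ^+ 2 <= (m * r)%:C by rewrite rE -rmorphXn lecR.
    apply: norm_le_tens => [|g].
      by rewrite mulr_ge0// ltW.
    by rewrite (le_trans _ (gPg g))// -zE lerDl mulr_ge0 ?pdot_ge0// ltW.
  have [->|rn] := eqVneq r 0; first by move=> _; exact: ltW.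
  by rewrite expr2 ler_pM2r// lt_neqAle eq_sym rn.
have zm : rdot k (Phi z k) <= m ^+ 2 * rdot k k.
  by rewrite (le_trans (gPg k))// ler_wpM2r ?rdot_ge0// expr2 ler_pM2l.
have kk : rdot k k = rdot X (tens z k) + e * gdot v (fun j => u j k).
  by rewrite -cE -uE gdot_gram tz rdotC pdotC.
have m2 : 0 < m ^+ 2 by rewrite exprn_gt0.
(* The sum |X - t z (.) k|^2 + e |v - t u k|^2 >= 0 reads 2 t |k|^2 <= |X|^2 + e |v|^2 + t^2 <k,
   Phi(z) k>, and this [t] makes the last term at most t |k|^2. *)
pose t := (m ^+ 2)^-1.
have y1 := rdot_ge0 (X - t%:C *: tens z k).
have y2 := pdot_ge0 (H := fun=> G) (fun j => v j - t%:C *: u j k).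
move: y1 y2 zm; rewrite -zE rdotBl !rdotBr !rdotZl !rdotZr.
rewrite pdotBl !pdotBr !pdotZl !pdotZr.
rewrite (rdotC (tens z k)) (pdotC (fun j => u j k) v) => y1 /(ler_wpM2l (ltW e0)).
rewrite mulr0 => y2 zm.
have t2 := ler_wpM2l (sqr_ge0 t) zm.
have tm : t ^+ 2 * (m ^+ 2 * rdot k k) = t * rdot k k.
  by rewrite /t; field; rewrite gt_eqF.
rewrite -ler_pdivrMl// -/t; move: kk y1 y2 t2; rewrite tm.
by move=> kk; rewrite kk; lra.
Qed.

(** On the graph [S] of L, [riesz] with the first projection as [iota] represents (a_1, a_2) |-> <g,
    a_2> by the vector T g; [amplified_bound] supplies the estimate. Passing to the graph takes the
    place of showing that L is well defined. *)
Lemma dual_operator : exists2 T : G -> H, bounded_operator T &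
  forall g y h, rdot (T g) (tens y h) = rdot g (Phi y h).
Proof.
pose S : set (H * G)%type := [set p | exists s : seq (E * G),
  p.1 = \sum_(q <- s) tens q.1 q.2 /\ p.2 = \sum_(q <- s) Phi q.1 q.2].
have PhiL y : linear (Phi y) := vna_linear_op hB (PhiB y).
have S0 : S 0 by exists [::]; rewrite !big_nil.
have SP k a b : S a -> S b -> S (k *: a + b).
  move=> [s [a1 a2]] [t [b1 b2]]; exists ([seq (q.1, k *: q.2) | q <- s] ++ t).
  rewrite !big_cat !big_map/= a1 a2 b1 b2 !scaler_sumr.
  split; congr (_ + _); apply: eq_bigr => q _; rewrite linear_scale//.
  exact: tens_linearr.
have Sbound a : S a -> rdot a.2 a.2 <= m ^+ 2 * rdot a.1 a.1.
  move=> [s [-> ->]]; rewrite !(big_tnth _ _ s).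
  exact: (amplified_bound (fun i => (tnth (in_tuple s) i).1)
                          (fun i => (tnth (in_tuple s) i).2)).
have pu (u v : unit -> H) : pdot (H := fun=> H) u v = rdot (u tt) (v tt).
  by rewrite /pdot (bigD1 tt)//= big1 ?addr0// => -[].
have /choice[T TP] g : exists w : H, (forall y h, rdot w (tens y h) = rdot g (Phi y h)) /\
    rdot w w <= m ^+ 2 * rdot g g.
  have [||a Sa|w [wl _ wC]] := @riesz R (H * G)%type S unit (fun=> H)
    (fun=> fst) (fun a => rdot g a.2) (m ^+ 2 * rdot g g) S0 SP.
  - by [].
  - by move=> k a b; rewrite rdotDr rdotZr.
  - rewrite pu; apply: mean_le (rdot_ge0 _) _; first by rewrite mulr_ge0 ?sqr_ge0 ?rdot_ge0.
    apply: le_trans (rdot_CauchySchwarz _ _) _.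
    by rewrite [leRHS]mulrAC [leRHS]mulrC ler_wpM2l ?rdot_ge0// Sbound.
  exists (w tt); split=> [y h|]; last by move: wC; rewrite pu.
  have /wl : S (tens y h, Phi y h) by exists [:: (y, h)]; rewrite !big_seq1.
  by rewrite pu.
exists T; last by move=> g; exact: (TP g).1.
apply/bounded_operatorP; split; last first.
  by exists (m ^+ 2); [exact: sqr_ge0|move=> g; exact: (TP g).2].
move=> k g h; apply: tens_ext => y b.
rewrite (TP _).1 !rdotDl !rdotZ_conj -(linear_scale _ _ (tens_linearr y)).
by rewrite !(TP _).1 linear_scale.
Qed.

Lemma dual_operator_closure (T : G -> H) :
  (forall g y h, rdot (T g) (tens y h) = rdot g (Phi y h)) ->
  forall (n : nat) (g : 'I_n -> G) (e : R), 0 < e -> exists2 x : E, setT x &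
    pdot (H := fun=> H) (fun i => T (g i) - tens x (g i))
                        (fun i => T (g i) - tens x (g i)) < e.
Proof.
move=> TP n g;
apply: (@dense_approximation R E setT _ (fun=> H) (fun i y => tens y (g i))) => //.
  by move=> i; exact: tens_linearl.
move=> v vS vp.
(* Here [L y] is L_y^* of the header. *)
have /choice[L LP] y : exists L : H -> G, adjoint (tens y) L.
  exact: adjoint_exists (interior_tensor_bounded hB hT y).
have Lv y : forall i, L y (v i) = 0.
  pose p i := tens y (L y (v i)).
  have pE i w : rdot (p i) w = rdot (L y (v i)) (L y w) by exact: adjoint_rdot.
  have pS (x : E) : setT x -> pdot (H := fun=> H) p (fun i => tens x (g i)) = 0.
    (* L_y L_y^* x = y <y, x> lies in [E]. *)
    move=> _; rewrite -(vS (hmact y (hmdot y x)) I); apply: eq_bigr => j _.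
    rewrite tens_act; last exact: hmdot_in.
    rewrite pE rdotC -(adjoint_rdot (LP y)) rdotC; congr rdot.
    congr (tens y _); apply: rdot_ext => w.
    by rewrite -(adjoint_rdot (LP y)) rdotC rdot_tens rdotC.
  have pT : pdot (H := fun=> H) p (fun i => T (g i)) = 0.
    (* Likewise L_y L_y^* T = y Phi(y)^* lies in [E], as L_y^* T is the adjoint [c] of [Phi y]. *)
    have [c Bc cP] := vna_adjoint hB (PhiB y).
    rewrite -(vS (hmact y c) I); apply: eq_bigr => j _.
    rewrite tens_act// pE rdotC -(adjoint_rdot (LP y)) rdotC; congr rdot.
    congr (tens y _); apply: rdot_ext => w.
    by rewrite -(adjoint_rdot (LP y)) rdotC TP rdotC (adjoint_rdot cP).
  apply: (@pdot_eq0 _ _ (fun=> G) (fun i => L y (v i))).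
  by rewrite -[RHS]pT vp//; apply: eq_bigr => j _; rewrite pE.
move=> i; apply: tens_ext => y b.
by rewrite rdot0l rdotC (adjoint_rdot (LP y)) Lv rdot0r.
Qed.

(** * Existence and uniqueness of the representing element *)

Lemma riesz_representation :
  sot_closed (range tens) -> exists x : E, forall y, Phi y = hmdot x y.
Proof.
move=> Ecl; have [T Tb TP] := dual_operator.
have [x _ xT] : range tens T.
  apply: (sot_closed_approx Ecl Tb) => n g e /(dual_operator_closure TP g)[x _ xe].
  exists (tens x); first by exists x.
  by move=> i; apply: le_lt_trans (rdot_le_pdot (H := fun=> H) _ i) xe.
exists x => y; apply/funext => h; apply: rdot_ext => g.
(* <g, Phi(y) h> = <T g, y (.) h> = <x (.) g, y (.) h> = <g, <x, y> h>. *)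
by rewrite -TP -xT rdotC rdot_tens rdotC.
Qed.

(** Both elements have the same elementary tensors, so x - x' has only zero ones and <x - x', x -
    x'> = 0. *)
Lemma hmdot_inj (x x' : E) : (forall y, hmdot x y = hmdot x' y) -> x = x'.
Proof.
move=> xx'; apply/eqP; rewrite -subr_eq0; apply/eqP/hmdot_eq0.
have tE g : tens x g = tens x' g.
  by apply: tens_ext => y h; rewrite rdotC rdot_tens xx' -rdot_tens rdotC.
have t0 g : tens (x - x') g = 0.
  by rewrite addrC -scaleN1r tens_linearl tE scaleN1r addNr.
by apply/funext => g; apply: rdot_ext => h; rewrite rdotC -rdot_tens t0 rdot0l rdot0r.
Qed.
End InteriorTensor.

Theorem theorem4p1 (R : realType) (G : hilbertType R) (B : set (G -> G))
    (hB : von_neumann_algebra B) (hnd : acts_nondegenerately B)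
    (E : hilbertModType B) (hE : von_neumann_module E) :
  self_dual E.
Proof.
move: hE => [H [tens [hT Ecl]]] Phi PhiB Plin Pact [M PM].
(* [M] may be any complex number; adding 1 to its modulus makes [m] positive, so that m^2 can be
   inverted. *)
pose m := complex.Re `|M| + 1.
have ME : `|M| = (complex.Re `|M|)%:C by rewrite RRe_real// ger0_real.
have M0 : 0 <= complex.Re `|M| by have := normr_ge0 M; rewrite ME lecR.
have Pm y g : rdot (Phi y g) (Phi y g) <= (m * complex.Re `|y|) ^+ 2 * rdot g g.
  have yE : `|y| = (complex.Re `|y|)%:C by rewrite RRe_real// ger0_real.
  have y0 : 0 <= complex.Re `|y| by have := normr_ge0 y; rewrite yE lecR.
  have : `|Phi y g| <= (m * complex.Re `|y|)%:C * `|g|.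
    have := le_trans (normr_ge0 _) (PM y g) => /ger0_norm.
    rewrite !normrM !normr_id => Me; rewrite (le_trans (PM y g))// -Me.
    rewrite rmorphM/= -yE !ler_wpM2r// ME lecR /m.
    by rewrite lerDl.
  rewrite -(@ler_pXn2r _ 2) ?nnegrE ?mulr_ge0// ?lecR ?mulr_ge0 ?addr_ge0//.
  by rewrite exprMn !sqr_norm_rdot -rmorphXn -rmorphM lecR.
have [x xP] := riesz_representation hB hT PhiB Plin Pact (ltr_wpDl M0 ltr01) Pm Ecl.
exists x; split=> // x' x'P.
by apply: (hmdot_inj hB hT) => y; rewrite -xP -x'P.
Qed.
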